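(* Let $\mathcal{A}$ be a central, essential, supersolvable hyperplane arrangement in $\mathbb{R}^d$, let $F=\{X_i\}_{i=0}^d$ be a modular flag for $\mathcal{A}$, let $c_0$ be any chamber incident to $F$, and let $c$ be any other chamber. Then: (i) there is a unique minimal gallery $r_0$ from $c_0$ to $c$ incident to $F$; (ii) this $r_0$ is an $L_2$-accessible vertex of the graph $G_2(c_0,c)$, i.e. $d_{G_2(c_0,c)}(r_0,r)=|L_2(r_0,r)|$ for every minimal gallery $r$ from $c_0$ to $c$.
   Context: A central, essential arrangement $\mathcal{A}$ is a finite set of linear hyperplanes in $\mathbb{R}^d$ with common intersection $\{0\}$; $L_i$ is the set of codimension-$i$ intersections of its hyperplanes. Chambers are components of the complement; $L_1(c,c')$ is the set of hyperplanes separating $c,c'$. A minimal gallery is a shortest path in the graph on chambers with $c,c'$ adjacent iff $|L_1(c,c')|=1$; a minimal gallery from $c_0$ to $c$ crosses each hyperplane of $L_1(c_0,c)$ exactly once and is determined by the crossing order. $L_2(c_0,c)$ is the set of $X\in L_2$ all of whose containing hyperplanes lie in $L_1(c_0,c)$. For minimal galleries $r,r'$ from $c_0$ to $c$, $L_2(r,r')$ is the set of $X\in L_2(c_0,c)$ such that $r,r'$ cross the hyperplanes containing $X$ in different orders. $G_2(c_0,c)$ has the minimal galleries from $c_0$ to $c$ as vertices, $r,r'$ adjacent iff $|L_2(r,r')|=1$. A modular coatom is a line $\ell\in L_{d-1}$ such that for any distinct $H,H'\in\mathcal{A}$ not containing $\ell$, $\ell+(H\cap H')\in\mathcal{A}$.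 $\mathcal{A}$ is supersolvable if $d=1$ or it has a modular coatom $\ell$ with localization $\mathcal{A}_\ell=\{H/\ell:H\supseteq\ell\}$ in $\mathbb{R}^d/\ell$ supersolvable. A flag is a chain $\{0\}=X_0\subset\cdots\subset X_d=\mathbb{R}^d$ of intersection subspaces with $\dim X_i=i$; it is modular if $X_1$ is a modular coatom of $\mathcal{A}$ and each $X_i/X_{i-1}$ is a modular coatom of $\mathcal{A}_{X_{i-1}}$. A chamber is incident to a subspace $X$ if its closure meets $X$ in a set of dimension $\dim X$, and to $F$ if incident to every $X_i$. A minimal gallery from $c_0$ to $c$ is incident to $F$ if whenever $i<j$ it crosses all hyperplanes of $L_1(c_0,c)$ containing $X_j$ before any hyperplane of $L_1(c_0,c)$ containing $X_i$ but not $X_j$. *)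

(* Defs.v *)
From HB Require Import structures.
From mathcomp Require Import all_boot all_order all_algebra.
From mathcomp Require Import reals.
Set Implicit Arguments. Unset Strict Implicit. Unset Printing Implicit Defensive.
Import Order.TTheory GRing.Theory Num.Theory.
Local Open Scope ring_scope.

(* A linear arrangement of n hyperplanes in R^d is given by normal vectors
   a i : 'cV_d ; points of R^d are row vectors x : 'rV_d, and
   H_i = { x | x *m a i = 0 } is the row space (kermx (a i)).  Subspaces of
   R^d are represented as row spaces of square matrices ('M_d), compared
   with the mxalgebra order (_ <= _)%MS. *)
Section Arrangement.
Variables (R : realType) (d n : nat) (a : 'I_n -> 'cV[R]_d).

Definition hyp (i : 'I_n) : 'M[R]_d := kermx (a i).

Definition flat_of (S : {set 'I_n}) : 'M[R]_d := (\bigcap_(i in S) hyp i)%MS.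

Definition is_flat (X : 'M[R]_d) : Prop := exists S : {set 'I_n}, (X == flat_of S)%MS.

Definition Lk (k : nat) : seq 'M[R]_d :=
  undup [seq <<flat_of T>>%MS | T <- enum [set: {set 'I_n}] & (\rank (flat_of T) + k == d)%N].

Definition arrangement : Prop :=
  (forall i, a i != 0) /\
  (forall i j, (hyp i == hyp j)%MS -> i = j) /\
  \rank (flat_of setT) = 0%N.

(* Chambers: a chamber is encoded by its (strict) sign vector, true meaning the
   positive side of H_i; it must be realized by some point. *)
Definition sv := {ffun 'I_n -> bool}.

Definition lin (x : 'rV[R]_d) (i : 'I_n) : R := (x *m a i) 0 0.

Definition is_chamber (c : sv) : Prop :=
  exists x : 'rV[R]_d, forall i, if c i then 0 < lin x i else lin x i < 0.

Definition closure (c : sv) (x : 'rV[R]_d) : Prop :=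
  forall i, if c i then 0 <= lin x i else lin x i <= 0.

Definition sep (c c' : sv) : {set 'I_n} := [set i | c i != c' i].

Definition adj (c c' : sv) : bool := #|sep c c'| == 1%N.

Definition is_gallery (c0 c : sv) (g : seq sv) : Prop :=
  (forall x, x \in g -> is_chamber x) /\ path adj c0 g /\ last c0 g = c.

Definition min_gallery (c0 c : sv) (g : seq sv) : Prop :=
  is_gallery c0 c g /\ forall g', is_gallery c0 c g' -> (size g <= size g')%N.

Definition crossed (c c' : sv) : option 'I_n := [pick i in sep c c'].
Definition crossings (c0 : sv) (g : seq sv) : seq 'I_n := pmap id (pairmap crossed c0 g).

Definition L2cc (c0 c : sv) : seq 'M[R]_d :=
  [seq X <- Lk 2 | [forall i, (X <= hyp i)%MS ==> (i \in sep c0 c)]].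

Definition order_on (c0 : sv) (X : 'M[R]_d) (g : seq sv) : seq 'I_n :=
  [seq i <- crossings c0 g | (X <= hyp i)%MS].

Definition L2rr (c0 c : sv) (r r' : seq sv) : seq 'M[R]_d :=
  [seq X <- L2cc c0 c | order_on c0 X r != order_on c0 X r'].

Definition G2adj (c0 c : sv) (r r' : seq sv) : bool := size (L2rr c0 c r r') == 1%N.

Definition G2walk (c0 c : sv) (r : seq sv) (p : seq (seq sv)) : Prop :=
  (forall s, s \in p -> min_gallery c0 c s) /\ path (G2adj c0 c) r p.

Definition G2dist_eq (c0 c : sv) (r r' : seq sv) (m : nat) : Prop :=
  (exists p, G2walk c0 c r p /\ last r p = r' /\ size p = m) /\
  (forall p, G2walk c0 c r p -> last r p = r' -> (m <= size p)%N).

(* Localization: subspaces of R^d/X are identified with subspaces of R^d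
   containing X; A_X consists of the hyperplanes H_i containing X.
   modular_over X Y : Y/X is a modular coatom of A_X. *)
Definition modular_over (X Y : 'M[R]_d) : Prop :=
  [/\ is_flat Y, (X <= Y)%MS, \rank Y = (\rank X).+1 &
   forall i j, i != j -> (X <= hyp i)%MS -> (X <= hyp j)%MS ->
     ~~ (Y <= hyp i)%MS -> ~~ (Y <= hyp j)%MS ->
     exists k, (X <= hyp k)%MS /\ ((Y + (hyp i :&: hyp j)) == hyp k)%MS].

(* ss_over k X : the localization A_X (living in a space of dimension k)
   is supersolvable. *)
Fixpoint ss_over (k : nat) (X : 'M[R]_d) : Prop :=
  match k with
  | 0 => False
  | k'.+1 => if k' is 0 then True else exists Y, modular_over X Y /\ ss_over k' Y
  end.

Definition supersolvable : Prop := ss_over d (0 : 'M[R]_d).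

Definition modular_flag (F : nat -> 'M[R]_d) : Prop :=
  [/\ (F 0%N == (0 : 'M[R]_d))%MS, (F d == 1%:M)%MS,
   (forall i, (i <= d)%N -> is_flat (F i) /\ \rank (F i) = i) &
   (forall i, (0 < i <= d)%N -> modular_over (F i.-1) (F i))].

(* chamber c incident to X: closure(c) /\ X spans X (has dimension dim X) *)
Definition chamber_incident (c : sv) (X : 'M[R]_d) : Prop :=
  exists P : 'M[R]_d,
    (forall k, closure c (row k P) /\ (row k P <= X)%MS) /\ (X <= P)%MS.

Definition chamber_incident_flag (F : nat -> 'M[R]_d) (c : sv) : Prop :=
  forall i, (i <= d)%N -> chamber_incident c (F i).

Definition gallery_incident (c0 c : sv) (F : nat -> 'M[R]_d) (r : seq sv) : Prop :=
  forall i j, (i < j <= d)%N -> forall h h',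
    h \in sep c0 c -> h' \in sep c0 c ->
    (F j <= hyp h)%MS -> (F i <= hyp h')%MS -> ~~ (F j <= hyp h')%MS ->
    (index h (crossings c0 r) < index h' (crossings c0 r))%N.

End Arrangement.

(* Main.v *)
(* Orient the normals so that every form f_i is positive on c0, let the level of
   H_i be the largest q with X_q contained in H_i, and choose v_q in X_q strictly
   on the c0-side of every hyperplane that does not contain X_q.  For H_i of level
   q, put ht_i = f_i / f_i(v_(q+1)): moving along v_(q+1) shifts all the heights
   of level q equally, and moving far along v_q makes all forms of lower level
   positive.  Modularity says exactly that ht_i - ht_j, for i <> j of the same
   level, is a nonzero multiple of some f_k of higher level; so, once the
   hyperplanes of higher level are crossed, the order in which those of level q
   are crossed is forced.  This gives existence and uniqueness of r0.
   If r differs from r0, let H_h be the first hyperplane that r crosses right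
   after some H_j of lower level.  Then r crosses all the hyperplanes through
   X = H_j /\ H_h consecutively, ending with H_h, and reversing this block is
   possible; the reversal removes exactly X from L_2(r0, r).  Iterating, the
   distance is at most |L_2(r0, r)|; it is at least that because an edge of G_2
   changes L_2(r0, _) by one element. *)

Require Import Defs.
From mathcomp Require Import all_boot all_order all_algebra.
From mathcomp Require Import reals.
From mathcomp Require Import ring lra zify.
Set Implicit Arguments. Unset Strict Implicit. Unset Printing Implicit Defensive.
Import Order.TTheory GRing.Theory Num.Theory.
Local Open Scope ring_scope.

(** * Sorted words, and a bound uniform over a finite family *)

Lemma not_sorted_split (T : Type) (e : rel T) (s : seq T) : ~~ sorted e s ->
  exists s1 i j s2, [/\ s = s1 ++ i :: j :: s2, sorted e (rcons s1 i) & ~~ e i j].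
Proof.
case: s => // x s; elim: s x => [|y s IHs] x //=.
have [exy|nexy] /= := boolP (e x y); last by move=> _; exists [::], x, y, s.
move=> /IHs[[|z s1] [i [j [s2 [/= ss1 se ne]]]]].
  case: ss1 ne => <- -> ne; exists [:: x], y, j, s2.
  by split=> //=; rewrite exy.
case: ss1 se => <- -> se; exists [:: x, y & s1], i, j, s2.
by split=> //=; rewrite exy.
Qed.

(** Serves to show that the hyperplanes through one flat form a final block of the word crossed so
    far. *)
Lemma pairwise_imply_cat_filter (T : Type) (p : pred T) (s : seq T) :
  pairwise (fun i j => p i ==> p j) s ->
  s = [seq i <- s | ~~ p i] ++ [seq i <- s | p i].
Proof.
elim: s => //= x s IHs /andP[px /IHs {1}->]; have [p_x|//] /= := boolP (p x).
suff ->: [seq i <- s | ~~ p i] = [::] by [].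
apply/size0nil/eqP; rewrite size_filter -leqn0 leqNgt -has_count -all_predC.
by apply: sub_all px => i; rewrite p_x /= => ->.
Qed.

(** Turns the realizability of a prefix of a sorted word into sign conditions relative to the next
    letter. *)
Lemma mem_take_pairwise (T : eqType) (e : rel T) (s : seq T) (x : T) k :
  irreflexive e -> transitive e -> pairwise e s -> (k < size s)%N ->
  forall i, (i \in take k s) = (i \in s) && e i (nth x s k).
Proof.
move=> e_irr e_tr es ks i.
have ss : s = take k s ++ nth x s k :: drop k.+1 s.
  by rewrite -drop_nth // cat_take_drop.
move: es; rewrite {1}ss pairwise_cat allrel_consr pairwise_cons -andbA.
case/and5P => /allP lt _ _ /allP gt _.
rewrite {2}ss mem_cat inE; case: (boolP (i \in take k s)) => [/lt ->//|ni] /=.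
have [->|_] /= := eqVneq; first by rewrite e_irr.
apply/esym/andP => -[/gt ei /e_tr/(_ ei)]; by rewrite e_irr.
Qed.

Lemma ex_strict_ub (R : numDomainType) (I : finType) (g : I -> R) :
  (forall i, g i \is Num.real) -> exists2 M, 0 < M & forall i, g i < M.
Proof.
move=> greal; exists (1 + \sum_i `|g i|).
  by rewrite ltr_pwDl // sumr_ge0.
move=> i; rewrite (bigD1 i) //= addrCA (le_lt_trans (real_ler_norm (greal i))) //.
by rewrite ltrDl ltr_pwDl // sumr_ge0.
Qed.

(** * Crossing words for linear forms graded by level *)

Section Word.
Variables (R : realFieldType) (V : lmodType R) (I : finType).
Variables (f : I -> V -> R) (lev : I -> nat) (v : nat -> V).
(* [fl j h m]: the hyperplane [m] contains the intersection of [j] and [h]. *)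
Variable fl : I -> I -> pred I.

Definition ht i x := f i x / f i (v (lev i).+1).

Hypothesis fD : forall i x t y, f i (x + t *: y) = f i x + t * f i y.
Hypothesis f_v0 : forall i q, (q <= lev i)%N -> f i (v q) = 0.
(** The bound [(lev j).+1] keeps [q] inside the flag without mentioning its length: in the
    application all levels are below [d]. *)
Hypothesis f_v_gt0 : forall i j q, (lev i < q <= (lev j).+1)%N -> 0 < f i (v q).
Hypothesis ht_sub : forall i j, i != j -> lev i = lev j -> exists k (l : R),
  [/\ (lev i < lev k)%N, l != 0 & forall x, ht i x - ht j x = l * f k x].
Hypothesis flP : forall j h m, (lev j < lev h)%N ->
  fl j h m <-> m = h \/ (lev m = lev j /\
    exists b, forall x, ht m x - ht j x = b * f h x).

(* [x] lies in the chamber reached from the base chamber by crossing [S]. *)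
Definition neg_on (S : seq I) x := forall i, if i \in S then f i x < 0 else 0 < f i x.
Definition realizable (S : seq I) := exists x, neg_on S x.

Lemma eq_realizable (S S' : seq I) : S =i S' -> realizable S -> realizable S'.
Proof. by move=> SS' [x Sx]; exists x => i; rewrite -SS'. Qed.

Lemma neg_onE (S : seq I) x i : neg_on S x -> (i \in S) = (f i x < 0).
Proof. by move/(_ i); case: ifP => // _ /lt_gtF->. Qed.

Lemma neg_onE_gt (S : seq I) x i : neg_on S x -> (i \notin S) = (0 < f i x).
Proof. by move/(_ i); case: ifP => // _ /lt_gtF->. Qed.

Lemma ht_lt0 i x : (ht i x < 0) = (f i x < 0).
Proof. by rewrite /ht pmulr_llt0 // invr_gt0 (f_v_gt0 (j := i)) // ltnS leqnn. Qed.

Lemma ht_gt0 i x : (0 < ht i x) = (0 < f i x).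
Proof. by rewrite /ht pmulr_lgt0 // invr_gt0 (f_v_gt0 (j := i)) // ltnS leqnn. Qed.

(* Moving far along [v (lev i0)] repairs the forms of lower level and does not
   see the others; moving along [v (lev i0).+1] shifts all heights of level
   [lev i0] by the same amount. *)
Lemma realizable_level x i0 : exists x', forall i,
  [/\ (lev i0 < lev i)%N -> f i x' = f i x,
      lev i = lev i0 -> if ht i x < ht i0 x then f i x' < 0 else 0 < f i x' &
      (lev i < lev i0)%N -> 0 < f i x'].
Proof.
have [M M_gt0 MP] : exists2 M, 0 < M & forall i, (ht i0 x - ht i x)^-1 < M.
  by apply: ex_strict_ub => i; rewrite num_real.
pose z := x + (M^-1 - ht i0 x) *: v (lev i0).+1.
have [N N_gt0 NP] : exists2 N, 0 < N & forall i, - f i z / f i (v (lev i0)) < N.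
  by apply: ex_strict_ub => i; rewrite num_real.
exists (z + N *: v (lev i0)) => i; split=> [lt|eq|lt].
- by rewrite !fD !f_v0 ?mulr0 ?addr0 // ltnW.
- rewrite fD (f_v0 (i := i)) ?eq // mulr0 addr0 /z fD -eq.
  have fv : 0 < f i (v (lev i).+1) by rewrite (f_v_gt0 (j := i)) // ltnS leqnn.
  have -> : f i x = ht i x * f i (v (lev i).+1) by rewrite divfK // gt_eqF.
  rewrite -mulrDl pmulr_llt0 // pmulr_lgt0 //.
  case: ltP => h; last by rewrite addrCA ltr_pwDl ?invr_gt0 // subr_ge0.
  have := MP i; rewrite -subr_gt0 in h.
  rewrite invf_plt ?posrE // => lt; lra.
- have fv : 0 < f i (v (lev i0)) by rewrite (f_v_gt0 (j := i0)) // lt leqnSn.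
  by rewrite fD; have := NP i; rewrite ltr_pdivrMr // => ?; lra.
Qed.

(** The order of crossings that incidence to the flag forces on the way to [x]. *)
Definition before x : rel I := fun i j =>
  (lev j < lev i)%N || ((lev i == lev j) && (ht i x < ht j x)).

Lemma before_irr x : irreflexive (before x).
Proof. by move=> i; rewrite /before ltnn ltxx andbF. Qed.

Lemma before_trans x : transitive (before x).
Proof.
move=> j i k; rewrite /before => /orP[ij|/andP[/eqP-> ij]] /orP[jk|/andP[/eqP<- jk]].
- by rewrite (ltn_trans jk ij).
- by rewrite ij.
- by rewrite jk.
- by rewrite eqxx (lt_trans ij jk) orbT.
Qed.

(** The difference of the heights is a nonzero multiple of some [f k], and no form vanishes inside a
    chamber. *)
Lemma ht_inj (S : seq I) x i j : neg_on S x -> i != j -> lev i = lev j ->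
  ht i x != ht j x.
Proof.
move=> Sx ij lij; have [k [l [_ l0 /(_ x) eq]]] := ht_sub ij lij.
rewrite -subr_eq0 eq mulf_neq0 //.
by have := Sx k; case: ifP => _ => [/ltr0_neq0|/lt0r_neq0].
Qed.

Definition realizable_prefixes (w : seq I) := forall k, realizable (take k w).

Lemma realizable_prefixes_cat s1 s2 : realizable_prefixes (s1 ++ s2) -> realizable s1.
Proof. by move/(_ (size s1)); rewrite take_size_cat. Qed.

(** Words sorted by this relation will be those of the galleries incident to the flag. *)
Definition levge : rel I := fun i j => (lev j <= lev i)%N.

Lemma levge_trans : transitive levge.
Proof. by move=> j i k ij jk; apply: leq_trans ij. Qed.

(* When [m] is about to be crossed, all forms of higher level of [w] are already
   crossed, hence the height of [m] compares to the heights below it as at [x]. *)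
Lemma pairwise_before w x : uniq w -> realizable_prefixes w -> pairwise levge w ->
  neg_on w x -> pairwise (before x) w.
Proof.
move=> uw rw lw wx; rewrite -sorted_pairwise; last exact: before_trans.
case: w => // i0 w in uw rw lw wx *.
apply/(sortedP i0) => k kw; set w' := i0 :: w in uw rw lw wx kw *.
set i := nth _ _ k; set m := nth _ _ k.+1.
have {lw} lw : {in gtn (size w') &, {homo nth i0 w' : a b / (a < b)%N >-> levge a b}}.
  exact/pairwiseP.
have := lw k k.+1 (ltnW kw) kw (ltnSn k); rewrite -/i -/m /levge /before.
rewrite leq_eqVlt => /orP[/eqP lim|->//]; rewrite lim eqxx ltnn /=.
have im : i != m by rewrite nth_uniq // ?neq_ltn ?leqnn // ltnW.
(* [z] lies in the chamber between the crossings of [i] and [m]. *)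
have [z zP] := rw k.+1.
have [e [l [le l0 eq]]] := ht_sub im (esym lim).
have iS : i \in take k.+1 w'.
  by rewrite (take_nth i0) ?mem_rcons ?inE ?eqxx // ltnW.
have mS : m \notin take k.+1 w'.
  move: uw; rewrite -{1}[w'](cat_take_drop k.+1) cat_uniq (drop_nth i0) //.
  by case/and3P => _ /= /norP[].
have hi : ht i z < 0 by rewrite ht_lt0 -(neg_onE _ zP).
have hm : 0 < ht m z by rewrite ht_gt0 -(neg_onE_gt _ zP).
(* The level of [e] exceeds that of [i], so if [e] occurs at all it occurs before [i]; hence [f e]
   has the same sign at [z] and at [x]. *)
have eS : (e \in take k.+1 w') = (e \in w').
  apply/idP/idP => [/mem_take//|ew]; apply/negPn/negP => eS.
  have : e \in drop k.+1 w'.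
    by move: ew; rewrite -{1}[w'](cat_take_drop k.+1) mem_cat (negPf eS).
  case/(nthP i0) => b; rewrite size_drop ltn_subRL nth_drop => be ee.
  move: (lw k (k.+1 + b)%N); rewrite ee -/i /levge [(lev e <= _)%N]leqNgt le => /(_ _ _ _)/negP.
  by apply=> //; [exact: ltnW|rewrite leq_addr].
have lz : l * f e z < 0 by rewrite -eq subr_lt0 (lt_trans hi).
rewrite -subr_lt0 eq.
move: (zP e) (wx e) lz; rewrite eS; case: ifP => _ a1 a2.
  by rewrite !nmulr_llt0.
by rewrite !pmulr_llt0.
Qed.


Lemma levge_sorted w : sorted levge w = pairwise levge w.
Proof. exact: sorted_pairwise levge_trans _. Qed.

(** * Words that lead to a fixed chamber *)

Section Target.
Variable y : V.
Hypothesis y_neq0 : forall i, f i y != 0.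

(** These are the crossing words of the minimal galleries to the chamber of [y]. *)
Definition good w := [/\ uniq w, realizable_prefixes w & neg_on w y].

(** Both words list the forms negative at [y], sorted by the same strict order [before y]. *)
Lemma levge_good_uniq w w' : good w -> good w' ->
  pairwise levge w -> pairwise levge w' -> w = w'.
Proof.
move=> [uw rw wy] [uw' rw' wy'] lw lw'.
apply: (irr_sorted_eq (@before_trans y) (@before_irr y)).
- by apply: pairwise_sorted; apply: pairwise_before.
- by apply: pairwise_sorted; apply: pairwise_before.
- by move=> i; rewrite (neg_onE i wy) (neg_onE i wy').
Qed.

Lemma before_total i j : i != j -> before y i j || before y j i.
Proof.
move=> ij; rewrite /before; case: ltngtP => //= lij.
suff : ht i y != ht j y by case: ltgtP.
by apply: (ht_inj (S := enum [pred i | f i y < 0])) => // k; rewrite mem_enum inE;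
  have := y_neq0 k; case: ltgtP.
Qed.

(** Sort the forms negative at [y] by [before y]. The prefix that stops in front of [i1] is realized
    by the point that [realizable_level y i1] provides. *)
Lemma ex_levge_good : exists2 w, good w & pairwise levge w.
Proof.
(* [sort] calls for a total relation, hence the reflexive closure; uniqueness of the letters gives
   the strict order back. *)
pose e i j := (i == j) || before y i j.
have e_tr : transitive e.
  rewrite /e => j i k /predU1P[->//|ij] /predU1P[<-|jk]; first by rewrite ij orbT.
  by rewrite (before_trans ij jk) orbT.
have e_tot : total e.
  by move=> i j; rewrite /e (eq_sym j); case: eqVneq => //= /before_total.
pose w := sort e (enum [pred i | f i y < 0]).
have memw i : (i \in w) = (f i y < 0) by rewrite mem_sort mem_enum inE.
have wy : neg_on w y by move=> i; rewrite memw; have := y_neq0 i; case: ltgtP.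
have uw : uniq w by rewrite sort_uniq enum_uniq.
have bw : pairwise (before y) w.
  have : pairwise [rel i j | e i j && [rel i j | i != j] i j] w.
    by rewrite pairwise_relI -uniq_pairwise uw -sorted_pairwise // sort_sorted.
  by apply: sub_pairwise => i j /= /andP[/predU1P[->|//]]; rewrite eqxx.
have lw : pairwise levge w.
  by apply: sub_pairwise bw => i j; rewrite /levge => /orP[/ltnW|/andP[/eqP->]].
exists w => //; split=> // k; have [wk|kw] := leqP (size w) k.
  by exists y; rewrite take_oversize.
have [i0 _] : {i0 | i0 \in w} by case: (w) kw => // i ? _; exists i; exact: mem_head.
set i1 := nth i0 w k; have wi1 : f i1 y < 0 by rewrite -memw mem_nth.
have [x' x'P] := realizable_level y i1; exists x' => i.
rewrite (mem_take_pairwise i0 (@before_irr y) (@before_trans y)) // memw.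
rewrite -/i1 /before; have [p1 p2 p3] := x'P i.
case: ltngtP p1 p2 p3 => /= [lt p1 _ _|lt _ _ ->//|leq _ p2 _].
- by rewrite p1 // andbT; have := y_neq0 i; case: ltgtP.
- by rewrite andbF.
- move: (p2 (esym leq)); case: ltP => [lt|]; last by rewrite andbF.
  by have -> : f i y < 0 by rewrite -ht_lt0 (lt_trans lt) // ht_lt0.
Qed.

(* [h] is the first form crossed too early, [j] the one crossed just before it. *)
Lemma flip w w0 : good w -> good w0 -> pairwise levge w0 -> w != w0 ->
  exists j h w', [/\ good w', (lev j < lev h)%N, 
    forall m, fl j h m -> m \in w,
    filter (fl j h) w != filter (fl j h) w' /\ filter (fl j h) w' = filter (fl j h) w0 &
    forall P : pred I, (forall i m, fl j h i -> fl j h m -> P i -> P m -> i = m) ->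
      filter P w = filter P w'].
Proof.
move=> gw gw0 lw0 ww0; have [uw rw wy] := gw.
have : ~~ sorted levge w.
  by rewrite levge_sorted; apply: contra ww0 => lw; apply/eqP/levge_good_uniq.
case/not_sorted_split => s1 [j [h [rest [w_def]]]].
(* [p] is the part of the word in front of [h]; it ends with [j] and is still sorted by level. *)
move Ep : (rcons s1 j) => p; rewrite levge_sorted /levge -ltnNge => lp jh.
have {w_def} w_def : w = p ++ h :: rest by rewrite w_def -Ep cat_rcons.
have up : uniq p by move: uw; rewrite w_def cat_uniq => /and3P[].
have rp : realizable_prefixes p.
  move=> k; have [kp|pk] := ltnP k (size p).
    by have := rw k; rewrite w_def take_cat kp.
  by rewrite take_oversize //; apply: (realizable_prefixes_cat (s2 := h :: rest)); rewrite -w_def.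
(* [x] and [x'] lie on the two sides of the crossing of [h], so only the form [f h] changes sign
   between them. *)
have [x px] : realizable p by rewrite -[p]take_size.
have [x' px'] : realizable (rcons p h).
  by apply: (realizable_prefixes_cat (s2 := rest)); rewrite cat_rcons -w_def.
have bp := pairwise_before up rp lp px.
have hp : h \notin p.
  by move: uw; rewrite w_def uniq_catC cons_uniq mem_cat negb_or => /andP[/andP[]].
have jp : j \in p by rewrite -Ep mem_rcons mem_head.
have flh : fl j h h by apply/flP => //; left.
have flj : fl j h j.
  by apply/flP => //; right; split=> //; exists 0 => z; rewrite subrr mul0r.
have hx : 0 < f h x by rewrite -(neg_onE_gt _ px).
have hx' : f h x' < 0 by rewrite -(neg_onE _ px') mem_rcons mem_head.
have same k : (lev j < lev k)%N -> k != h -> (f k x < 0) = (f k x' < 0).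
  by move=> _ kh; rewrite -(neg_onE _ px) -(neg_onE _ px') mem_rcons inE (negPf kh).
(* The difference of the heights is a multiple of some [f k]; unless [k] is [h], its sign is the
   same at [x] and [x']. *)
have keep i m : lev i = lev m ->
    (exists b, forall z, ht i z - ht m z = b * f h z) \/
    (lev j = lev m -> ht i x < ht m x -> ht i x' < ht m x').
  move=> lim; have [->|im] := eqVneq i m; first by right; rewrite ltxx.
  have [k [l [lk l0 eq]]] := ht_sub im lim.
  have [kh|kh] := eqVneq k h; first by left; exists l; rewrite -kh.
  right=> ljm; rewrite -[ht i x < _]subr_lt0 -[ht i x' < _]subr_lt0 !eq.
  have : (f k x < 0) = (f k x' < 0) by apply: same; rewrite // ljm -lim.
  have : f k x != 0 by have := px k; case: ifP => _; case: ltgtP.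
  have : f k x' != 0 by have := px' k; case: ifP => _; case: ltgtP.
  have [xk|xk] := boolP (f k x < 0).
    by move=> _ _ /esym x'k; rewrite !nmulr_llt0.
  move: xk; case: ltgtP => // xk _; case: ltgtP => // x'k _ _ _.
  by rewrite !pmulr_llt0.
have flE m : fl j h m -> m != h -> lev m = lev j /\
    exists b, forall z, ht m z - ht j z = b * f h z.
  by move/(flP _ jh) => [->|//]; rewrite eqxx.
have fl_sub i m : fl j h i -> i != h -> lev i = lev m ->
    (exists b, forall z, ht i z - ht m z = b * f h z) -> fl j h m.
  move=> /flE/[apply]-[lij [b bP]] lim [b' b'P]; apply/flP => //; right.
  split; first by rewrite -lim.
  by exists (b - b') => z; rewrite mulrBl -bP -b'P; ring.
(* If [m] were not crossed yet, [ht m - ht j], a multiple of [f h], would be positive on both sides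
   of [h]. *)
have fl_p m : fl j h m -> m != h -> m \in p.
  move=> flm mh; apply: contraT => mp; have [lm [b bP]] := flE _ flm mh.
  have : 0 < ht m x by rewrite ht_gt0 -(neg_onE_gt _ px).
  have : 0 < ht m x'.
    by rewrite ht_gt0 -(neg_onE_gt _ px') mem_rcons inE negb_or mh.
  have : ht j x < 0 by rewrite ht_lt0 -(neg_onE _ px).
  have : ht j x' < 0 by rewrite ht_lt0 -(neg_onE _ px') mem_rcons inE jp orbT.
  move: (bP x) (bP x') => e1 e2 j' j1 m' m1.
  have b0 : 0 < b * f h x by lra.
  have b1 : 0 < b * f h x' by lra.
  by move: b0 b1; rewrite (pmulr_lgt0 _ hx) (nmulr_lgt0 _ hx') => /lt_gtF->.
have p_h m : m \in p -> m != h by apply: contraTneq => ->.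
have lev_p m : m \in p -> (lev j <= lev m)%N.
  move: lp; rewrite -Ep pairwise_rcons mem_rcons inE => /andP[/allP lp _].
  by case/predU1P => [->//|/lp].
have befj m : m \in p -> m != j -> before x m j.
  move: bp; rewrite -Ep pairwise_rcons mem_rcons inE => /andP[/allP bpj _].
  by case/predU1P => [->|/bpj//]; rewrite eqxx.
(* Let [i] be in the flat block and [m], outside it, come after [i] and before [j]. Then
   [ht i < ht m < ht j] would hold at [x] and at [x'], but [ht i - ht j] is a multiple of [f h],
   which changes sign. *)
have p_split : p = [seq i <- p | ~~ fl j h i] ++ [seq i <- p | fl j h i].
  apply: pairwise_imply_cat_filter.
  apply: (sub_in_pairwise (P := mem p) (r := before x)) bp; last exact/allP.
  move=> i m ip mp bim; apply/implyP => fli.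
  have ih := p_h _ ip; have [lij [b bP]] := flE _ fli ih.
  have [->//|mj] := eqVneq m j.
  have lmj : lev m = lev j.
    by apply/eqP; rewrite eqn_leq lev_p // andbT -lij; case/orP: bim => [/ltnW|/andP[/eqP->]].
  have hij : ht i x < ht m x.
    by move: bim; rewrite /before lij lmj ltnn eqxx.
  have hmj : ht m x < ht j x.
    by move: (befj _ mp mj); rewrite /before lmj ltnn eqxx.
  have [eb|k1] := keep i m (etrans lij (esym lmj)).
    by apply: (fl_sub i) => //; rewrite lij lmj.
  have [[b' b'P]|k2] := keep m j lmj; first by apply/flP => //; right; split=> //; exists b'.
  have := k1 (esym lmj) hij; have := k2 erefl hmj; have e1 := bP x; have e2 := bP x'.
  move=> l1 l2; have b0 : b * f h x < 0 by lra.
  have b1 : b * f h x' < 0 by lra.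
  by move: b0 b1; rewrite (pmulr_llt0 _ hx) (nmulr_llt0 _ hx') => /lt_gtF->.
move: p_split; move Es : [seq i <- p | ~~ fl j h i] => s.
move Et : [seq i <- p | fl j h i] => t p_split.
have mem_t m : (m \in t) = fl j h m && (m \in p) by rewrite -Et mem_filter.
have mem_s m : (m \in s) = ~~ fl j h m && (m \in p) by rewrite -Es mem_filter.
have lev_t m : m \in t -> lev m = lev j.
  by rewrite mem_t => /andP[flm /p_h mh]; case: (flE _ flm mh).
(* Height differences within [t] are multiples of [f h], so beyond [h] the order of the heights is
   reversed. *)
have t_flip z : f h z < 0 -> pairwise (fun i m => ht m z < ht i z) t.
  move=> hz; have bt : pairwise (before x) t by rewrite -Et pairwise_filter.
  apply: (sub_in_pairwise (P := mem t)) bt; last exact/allP.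
  move=> i m it mt; rewrite /before !lev_t // ltnn eqxx /=.
  move: it mt; rewrite !mem_t => /andP[fli /p_h ih] /andP[flm /p_h mh] im.
  have [_ [b bP]] := flE _ fli ih; have [_ [b' b'P]] := flE _ flm mh.
  have e1 : ht m x - ht i x = (b' - b) * f h x by rewrite mulrBl -bP -b'P; ring.
  have e2 : ht m z - ht i z = (b' - b) * f h z by rewrite mulrBl -bP -b'P; ring.
  move: im; rewrite -subr_gt0 e1 (pmulr_lgt0 _ hx) => b0.
  by rewrite -subr_lt0 e2 pmulr_rlt0.
(* A comparison lost between [x] and [x'] would make the difference a multiple of [f h], and then
   [i] would belong to the flat block. *)
have s_lt_t i m : lev i = lev j -> i \in s -> m \in t -> ht i x' < ht m x'.
  move=> lij si tm; have [[b bP]|] := keep i m (etrans lij (esym (lev_t _ tm))).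
    move: (tm) si; rewrite mem_t mem_s => /andP[flm /p_h mh].
    rewrite (fl_sub m) //; first by rewrite lev_t.
    by exists (- b) => z; rewrite mulNr -bP; ring.
  apply; first by rewrite lev_t.
  move: bp; rewrite p_split pairwise_cat => /andP[/allrelP/(_ _ _ si tm) + _].
  by rewrite /before lij (lev_t _ tm) ltnn eqxx.
have ut : uniq t by rewrite -Et filter_uniq.
pose w' := s ++ h :: rev t ++ rest.
have ww' : perm_eq w w'.
  apply/permP => P; rewrite w_def p_split /w' !count_cat /= !count_cat count_rev -!addnA.
  by congr (_ + _)%N; rewrite addnCA.
have rw' : realizable_prefixes w'.
  move=> k; rewrite /w' take_cat; case: ltnP => [ks|].
    by have := rw k; rewrite w_def p_split -catA take_cat ks.
  rewrite leq_eqVlt => /predU1P[<-|].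
    by rewrite subnn take0 cats0; apply: (realizable_prefixes_cat (s2 := t)); rewrite -p_split.
  rewrite -subn_gt0; case: (k - size s)%N => // k' _ /=.
  rewrite take_cat size_rev; case: ltnP => [k't|tk'].
    (* The prefix is [s ++ h :: rev t2]. Let [i0] be the letter that comes next: among the forms of
       level [lev j], those lower than [i0] at [x'] are exactly those in [s] or [t2], so
       [realizable_level x' i0] gives the point. *)
    rewrite take_rev; set t2 := drop _ t.
    have : t = take (size t - k') t ++ t2 by rewrite cat_take_drop.
    have : (0 < size (take (size t - k') t))%N by rewrite size_take_min leq_min subn_gt0 k't (leq_ltn_trans _ k't).
    case/lastP: (take _ _) => // t1 i0 _; rewrite cat_rcons => t_split.
    have i0t : i0 \in t by rewrite t_split mem_cat mem_head orbT.
    have := t_flip x' hx'; rewrite {1}t_split pairwise_cat allrel_consr /= -andbA.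
    case/and5P => /allP gt1 _ _ /allP lt2 _.
    have i0p : i0 \in p by move: i0t; rewrite mem_t => /andP[].
    have i0x' : ht i0 x' < 0.
      by rewrite ht_lt0 -(neg_onE _ px') mem_rcons inE i0p orbT.
    have [x2 x2P] := realizable_level x' i0; exists x2 => i.
    have {x2P} [] := x2P i; rewrite lev_t // mem_cat inE mem_rev.
    have pi : (i \in p) = (i \in s) || (i \in t) by rewrite p_split mem_cat.
    have ti : (i \in t) = [|| i \in t1, i == i0 | i \in t2].
      by rewrite t_split mem_cat inE.
    case: (ltngtP (lev i) (lev j)) => [lt _ _ /(_ isT)|gt /(_ isT)-> _ _|eq _ /(_ eq) + _].
    + have ip : i \notin p by apply: contraL lt => /lev_p; rewrite -leqNgt.
      have ih : i != h by apply: contraTneq lt => ->; rewrite -leqNgt ltnW.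
      by move: ip; rewrite pi ti (negPf ih) => /norP[/negPf-> /norP[_ /norP[_ /negPf->]]].
    + have it : i \notin t by apply: contraL gt => /lev_t ->; rewrite ltnn.
      have := px' i; rewrite mem_rcons inE pi (negPf it) orbF orbC.
      by move: it; rewrite ti => /norP[_ /norP[_ /negPf->]]; rewrite orbF.
    + have ih : i != h by apply: contraTneq jh => <-; rewrite eq ltnn.
      rewrite (negPf ih) /=; suff -> : (ht i x' < ht i0 x') = (i \in s) || (i \in t2) by [].
      have [si|si] /= := boolP (i \in s); first exact: s_lt_t.
      have [/lt2|it2] /= := boolP (i \in t2); first by [].
      have [/gt1/lt_gtF//|it1] := boolP (i \in t1).
      have [->|ii0] := eqVneq i i0; first exact: ltxx.
      apply/lt_gtF/(lt_trans i0x'); rewrite ht_gt0 -(neg_onE_gt _ px') mem_rcons inE.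
      by rewrite pi ti (negPf ih) (negPf si) (negPf it1) (negPf it2) (negPf ii0).
  (* Past the reversed block, the prefix has the same letters as a prefix of [w]. *)
  have := rw (size p + (k' - size t).+1)%N; rewrite w_def take_cat ltnNge leq_addr /= addKn /=.
  apply: eq_realizable => i; rewrite p_split !(mem_cat, inE) mem_rev.
  by do !case: (_ \in _); rewrite ?orbT ?orbF.
have s0 : filter (fl j h) s = [::].
  by rewrite -Es -filter_predI (eq_filter (a2 := pred0)) ?filter_pred0 // => i /=; rewrite andbN.
have tt : filter (fl j h) t = t by rewrite -Et filter_id.
have r0 : filter (fl j h) rest = [::].
  apply/eqP; rewrite -(negbK (_ == _)) -has_filter; apply/hasPn => m mr.
  have [h' mp] : m != h /\ m \notin p.
    move: uw; rewrite w_def cat_uniq => /and3P[_ /hasPn np /= /andP[hr _]].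
    split; first by apply: contraNneq hr => <-.
    by apply: np; rewrite inE mr orbT.
  by apply: contra mp => /fl_p; apply.
have fw : filter (fl j h) w = rcons t h.
  by rewrite w_def p_split !filter_cat s0 tt /= flh r0 cats1.
have fw' : filter (fl j h) w' = h :: rev t.
  by rewrite /w' !filter_cat /= flh filter_cat s0 r0 filter_rev tt cats0.
have gw' : good w'.
  split=> //; first by rewrite -(perm_uniq ww').
  by move=> i; rewrite -(perm_mem ww'); apply: wy.
exists j, h, w'; split=> //.
- move=> m flm; rewrite w_def mem_cat inE.
  by have [//|mh] := eqVneq m h; rewrite ?orbT // fl_p.
- split; rewrite ?fw fw'.
    have jt : j \in t by rewrite mem_t flj.
    apply/eqP; case: (t) jt mem_t => // i ? _ mem_t [ih _].
    by move/negP: hp; apply; have := mem_t i; rewrite mem_head ih => /esym/andP[].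
  (* As [f h y < 0], the reversed block is sorted by [before y]; so is the block of [w0], and the
     letters agree. *)
  have [uw0 rw0 wy0] := gw0.
  apply: (irr_sorted_eq (@before_trans y) (@before_irr y)).
  + have hy : f h y < 0 by rewrite -(neg_onE _ wy) w_def mem_cat mem_head orbT.
    rewrite /= path_min_sorted; last first.
      by apply/allP => m; rewrite mem_rev => /lev_t lm; rewrite /before lm jh.
    rewrite rev_sorted; apply: pairwise_sorted.
    apply: (sub_in_pairwise (P := mem t)) (t_flip y hy); last exact/allP.
    by move=> i m it mt /=; rewrite /before !lev_t // ltnn eqxx.
  + by apply: pairwise_sorted; apply: pairwise_filter; apply: pairwise_before.
  + move=> i; rewrite -fw' !mem_filter -(perm_mem ww').
    by rewrite (neg_onE _ wy) (neg_onE _ wy0).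
move=> P P1; rewrite w_def p_split /w' -catA -cat_rcons.
rewrite -[h :: rev t ++ _]/((h :: rev t) ++ rest) [LHS]filter_cat [RHS]filter_cat.
congr (_ ++ _); rewrite [LHS]filter_cat [RHS]filter_cat; congr (_ ++ _).
(* [P] selects at most one letter of the block, so the reversal cannot be seen through [P]. *)
apply: perm_small_eq.
  have : uniq [seq i <- h :: rev t | P i].
    by rewrite filter_uniq //= mem_rev rev_uniq ut andbT mem_t (negPf hp) andbF.
  have : {in [seq i <- h :: rev t | P i], forall m, fl j h m /\ P m}.
    move=> m; rewrite mem_filter inE mem_rev mem_t => /andP[Pm /predU1P[mh|/andP[]//]].
    by rewrite {1}mh.
  case: [seq _ <- _ | _] => [|m [|i l]] //= H /andP[+ _]; rewrite inE => /norP[/eqP[]].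
  have [|flm Pm] := H m; first exact: mem_head.
  have [|fli Pi] := H i; first by rewrite !inE eqxx orbT.
  exact: P1.
by apply: perm_filter; rewrite perm_rcons perm_cons perm_sym perm_rev.
Qed.

End Target.
End Word.

(** * Counting in filtered lists *)

Lemma leq_size_filter_neq (T : Type) (U : eqType) (s : seq T) (a b c : T -> U) :
  (size [seq x <- s | a x != c x] <=
   size [seq x <- s | a x != b x] + size [seq x <- s | b x != c x])%N.
Proof.
rewrite !size_filter -count_predUI; apply: leq_trans (leq_addr _ _).
by apply: sub_count => x /=; case: (eqVneq (a x) (b x)) => [->|].
Qed.

Lemma size_filter_flip (T : eqType) (s : seq T) (p q : pred T) x : uniq s ->
  x \in s -> p x -> ~~ q x -> {in s, forall z, z != x -> p z = q z} ->
  size (filter p s) = (size (filter q s)).+1.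
Proof.
move=> us xs px nqx pq; rewrite !size_filter.
rewrite !(permP (perm_to_rem xs)) /= px (negPf nqx) add0n add1n; congr _.+1.
by apply: eq_in_count => z; rewrite mem_rem_uniq // inE => /andP[/pq+ /[dup] zs _]; apply.
Qed.

Lemma size_filter_pred1 (T : eqType) (s : seq T) (p : pred T) x : uniq s ->
  x \in s -> p x -> {in s, forall z, z != x -> ~~ p z} -> size (filter p s) = 1%N.
Proof.
move=> us xs px np; rewrite size_filter.
have -> : 1%N = count_mem x s by rewrite count_uniq_mem // xs.
by apply: eq_in_count => z zs /=; have [->|/(np z zs)/negPf] := eqVneq z x.
Qed.

(** * Galleries as words of crossed hyperplanes *)

Section Gallery.
Variable n : nat.
Implicit Types (c : sv n) (w : seq 'I_n) (g : seq (sv n)).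

Definition toggle c (i : 'I_n) : sv n := [ffun k => c k (+) (k == i)].

(** Like [is_gallery], [scanl] leaves out the starting chamber. *)
Definition gallery_of c w : seq (sv n) := scanl toggle c w.

Lemma sep_toggle c i : sep c (toggle c i) = [set i].
Proof. by apply/setP => k; rewrite !inE ffunE; case: (k == i); case: (c k). Qed.

Lemma crossed_toggle c i : crossed c (toggle c i) = Some i.
Proof.
rewrite /crossed sep_toggle; case: pickP => [k|/(_ i)]; rewrite inE ?eqxx //.
by move/eqP->.
Qed.

Lemma adjP c c' : reflect (exists i, c' = toggle c i) (adj c c').
Proof.
apply: (iffP idP) => [/cards1P[i /setP ic]|[i ->]]; last first.
  by rewrite /adj sep_toggle cards1.
exists i; apply/ffunP => k; have := ic k; rewrite !inE ffunE => <-.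
by case: (c k); case: (c' k).
Qed.

Lemma crossings_gallery_of c w : crossings c (gallery_of c w) = w.
Proof.
rewrite /crossings /gallery_of; elim: w c => //= i w IHw c.
by rewrite crossed_toggle /= IHw.
Qed.

Lemma path_gallery_of c w : path (@adj n) c (gallery_of c w).
Proof. by elim: w c => //= i w IHw c; rewrite IHw andbT; apply/adjP; exists i. Qed.

Lemma pathP_gallery c g : path (@adj n) c g -> exists w, g = gallery_of c w.
Proof.
elim: g c => [|c' g IHg] c /=; first by exists [::].
by case/andP => /adjP[i ->] /IHg[w ->]; exists (i :: w).
Qed.

Lemma last_gallery_of c w : last c (gallery_of c w) = foldl toggle c w.
Proof. by elim: w c => //= i w IHw c; rewrite IHw. Qed.

Lemma mem_gallery_of c w c' : c' \in gallery_of c w ->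
  exists k, c' = foldl toggle c (take k w).
Proof.
case/(nthP c) => k; rewrite size_scanl => kw; rewrite nth_scanl // => <-.
by exists k.+1.
Qed.

Lemma foldl_toggle_in_gallery c w k : (0 < k <= size w)%N ->
  foldl toggle c (take k w) \in gallery_of c w.
Proof.
case: k => // k kw; rewrite -(nth_scanl c) // mem_nth //.
by rewrite size_scanl.
Qed.

Lemma foldl_toggle c w i : uniq w -> foldl toggle c w i = c i (+) (i \in w).
Proof.
elim: w c => [|k w IHw] c /=; first by rewrite addbF.
case/andP => kw /IHw->; rewrite ffunE inE -addbA; congr (_ (+) _).
by have [->|] := eqVneq i k; rewrite ?(negPf kw).
Qed.

Lemma foldl_toggle_notin c w i : i \notin w -> foldl toggle c w i = c i.
Proof.
elim: w c => //= k w IHw c; rewrite inE => /norP[ik /IHw->].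
by rewrite ffunE (negPf ik) addbF.
Qed.

End Gallery.

(** * Minimal galleries correspond to good words *)

Section MinGallery.
Variables (R : realType) (d n : nat) (a : 'I_n -> 'cV[R]_d) (c0 c : sv n).

Definition signed_normal (i : 'I_n) : 'cV[R]_d := ((-1) ^+ (~~ c0 i) : R) *: a i.

Definition signed_lin i (x : 'rV[R]_d) : R := (x *m signed_normal i) 0 0.

Local Notation f := signed_lin.

Lemma signed_linE i x : f i x = (-1) ^+ (~~ c0 i) * lin a x i.
Proof. by rewrite /f /signed_normal -scalemxAr mxE. Qed.

Lemma signed_linD i x t z : f i (x + t *: z) = f i x + t * f i z.
Proof. by rewrite /f mulmxDl -scalemxAl !mxE. Qed.

Lemma neg_onP (b : sv n) (s : seq 'I_n) x : (forall i, b i = c0 i (+) (i \in s)) ->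
  (forall i, if b i then 0 < lin a x i else lin a x i < 0) <-> neg_on f s x.
Proof.
move=> bP; split=> H i; move: (H i); rewrite bP signed_linE;
  by case: (c0 i); case: (i \in s) => /=; rewrite ?expr0 ?expr1 ?mul1r ?mulN1r ?oppr_gt0 ?oppr_lt0.
Qed.

Lemma is_chamberP (s : seq 'I_n) : uniq s ->
  is_chamber a (foldl (@toggle n) c0 s) <-> realizable f s.
Proof.
move=> us; have e i := foldl_toggle c0 i us.
by split=> -[x xP]; exists x; apply/(neg_onP x e).
Qed.

Hypothesis c0_chamber : is_chamber a c0.
Variable y : 'rV[R]_d.
Hypothesis yP : forall i, if c i then 0 < lin a y i else lin a y i < 0.

Lemma target_neg i : (f i y < 0) = (i \in sep c0 c).
Proof.
have := yP i; rewrite signed_linE inE; case: (c0 i); case: (c i) => /= h;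
  by rewrite ?expr0 ?expr1 ?mul1r ?mulN1r ?oppr_lt0 ?h // lt_gtF.
Qed.

Lemma target_neq0 i : f i y != 0.
Proof.
rewrite signed_linE mulf_neq0 ?signr_eq0 //.
by have := yP i; case: (c i) => [/lt0r_neq0|/ltr0_neq0].
Qed.

Lemma good_mem w i : good f y w -> (i \in w) = (i \in sep c0 c).
Proof. by case=> _ _ /neg_onE ->; rewrite target_neg. Qed.

Lemma good_size w : good f y w -> size w = #|sep c0 c|.
Proof.
move=> gw; have [uw _ _] := gw; rewrite -(card_uniqP uw).
by apply: eq_card => i; rewrite (good_mem i gw).
Qed.

Lemma gallery_crosses w i : is_gallery a c0 c (gallery_of c0 w) ->
  i \in sep c0 c -> i \in w.
Proof.
case=> _ [_ ]; rewrite last_gallery_of => <-; apply: contraTT => iw.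
by rewrite inE foldl_toggle_notin // eqxx.
Qed.

Lemma good_gallery w : good f y w -> is_gallery a c0 c (gallery_of c0 w).
Proof.
move=> gw; have [uw rw wy] := gw; split; last split.
- move=> _ /mem_gallery_of[k ->]; apply/is_chamberP; first exact: take_uniq.
  exact: rw.
- exact: path_gallery_of.
- rewrite last_gallery_of; apply/ffunP => i; rewrite foldl_toggle // (good_mem i gw) inE.
  by case: (c0 i); case: (c i).
Qed.

(** Every gallery crosses all of [sep c0 c], and a good word crosses nothing else and nothing twice.
    The given [w0] shows that this bound is attained, so every minimal gallery attains it. *)
Lemma min_galleryP w0 g : good f y w0 ->
  min_gallery a c0 c g <-> exists2 w, good f y w & g = gallery_of c0 w.
Proof.
move=> gw0; split=> [[gg mg]|[w gw ->]].
  have [gc [gp gl]] := gg; have [w gE] := pathP_gallery gp.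
  have sw : {subset enum (sep c0 c) <= w}.
    by move=> i; rewrite mem_enum => /gallery_crosses; apply; rewrite -gE.
  have szw : (size w <= size (enum (sep c0 c)))%N.
    by rewrite -cardE -(good_size gw0); move: (mg _ (good_gallery gw0)); rewrite gE !size_scanl.
  have uw := leq_size_uniq (enum_uniq _) sw szw.
  have [_ memw] := uniq_min_size (enum_uniq _) sw szw.
  exists w => //; split=> // [k|i]; last first.
    by rewrite -memw mem_enum -target_neg; have := target_neq0 i; case: ltgtP.
  apply/is_chamberP; first exact: take_uniq.
  (* The empty prefix stands for [c0], which is not listed in the gallery. *)
  have [->|k_gt0] := posnP k; first by rewrite take0.
  have [kw|/ltnW wk] := leqP k (size w).
    by apply: gc; rewrite gE foldl_toggle_in_gallery // k_gt0.
  rewrite take_oversize // -last_gallery_of -gE.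
  have := mem_last c0 g; rewrite inE => /predU1P[->//|]; exact: gc.
split=> [|g' gg']; first exact: good_gallery.
have [_ [/pathP_gallery[w' g'E] _]] := gg'.
rewrite g'E !size_scanl (good_size gw) cardE uniq_leq_size ?enum_uniq // => i.
by rewrite mem_enum; apply: gallery_crosses; rewrite -g'E.
Qed.
End MinGallery.

(** * Linear forms vanishing on given kernels *)

Lemma sub_kermx_factor (K : fieldType) d p q (A : 'M[K]_(d, p)) (B : 'M[K]_(d, q)) :
  (kermx A <= kermx B)%MS -> B = A *m (pinvmx A *m B).
Proof.
(* [A] kills the rows of [1%:M - A *m pinvmx A], hence so does [B]. *)
move=> AB; have : (1%:M - A *m pinvmx A <= kermx B)%MS.
  by apply: submx_trans AB; apply/sub_kermxP; rewrite mulmxBl mul1mx mulmxKpV ?subrr.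
by move/sub_kermxP; rewrite mulmxBl mul1mx mulmxA => /eqP; rewrite subr_eq0 => /eqP.
Qed.

Lemma sub_kermx_col (K : fieldType) d (a b : 'cV[K]_d) :
  (kermx a <= kermx b)%MS -> exists l : K, b = l *: a.
Proof.
move/sub_kermx_factor => ->; set D := _ *m b; exists (D 0 0).
by rewrite {1}[D]mx11_scalar mul_mx_scalar.
Qed.

Lemma sub_cap_kermx_col (K : fieldType) d (a1 a2 b : 'cV[K]_d) :
  (kermx a1 :&: kermx a2 <= kermx b)%MS -> exists l m : K, b = l *: a1 + m *: a2.
Proof.
move=> sub; have : (kermx (row_mx a1 a2) <= kermx b)%MS.
  apply: submx_trans sub; rewrite sub_capmx; apply/andP.
  have := mulmx_ker (row_mx a1 a2); rewrite mul_mx_row -row_mx0 => /eq_row_mx[e1 e2].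
  by split; apply/sub_kermxP.
move/sub_kermx_factor; set D := _ *m b => ->; exists (usubmx D 0 0), (dsubmx D 0 0).
by rewrite -{1}[D]vsubmxK mul_row_col -!mul_mx_scalar -!mx11_scalar.
Qed.

Lemma sub_kermx_lin (K : fieldType) m d p (A : 'M[K]_(m, d)) (u w : 'M_(d, p)) l l' :
  (A <= kermx u)%MS -> (A <= kermx w)%MS -> (A <= kermx (l *: u + l' *: w))%MS.
Proof.
move=> /sub_kermxP Au /sub_kermxP Aw; apply/sub_kermxP.
by rewrite mulmxDr -!scalemxAr Au Aw !scaler0 addr0.
Qed.

(** * Levels and heights defined by a modular flag *)

Section Flag.
Variables (R : realType) (d n : nat) (a : 'I_n -> 'cV[R]_d) (F : nat -> 'M[R]_d).
Variable c0 : sv n.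
Hypothesis arrA : arrangement a.
Hypothesis flagF : modular_flag a F.
Hypothesis incF : chamber_incident_flag a F c0.

Local Notation b := (signed_normal a c0).
Local Notation f := (signed_lin a c0).

Lemma sub_hyp_signed m (X : 'M[R]_(m, d)) i : (X <= hyp a i)%MS = (X <= kermx (b i))%MS.
Proof.
apply/sub_kermxP/sub_kermxP; rewrite -scalemxAr.
  by move=> ->; rewrite scaler0.
by move/eqP; rewrite scaler_eq0 signr_eq0 /= => /eqP.
Qed.

Lemma sub_hypP i (x : 'rV[R]_d) : (x <= hyp a i)%MS = (f i x == 0).
Proof.
rewrite sub_hyp_signed; apply/sub_kermxP/eqP => [|e]; rewrite /signed_lin.
  by move=> ->; rewrite mxE.
by rewrite [LHS]mx11_scalar; move: e; rewrite /signed_lin => ->; rewrite raddf0.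
Qed.

Lemma rank_hyp i : (\rank (hyp a i)).+1 = d.
Proof.
have [a0 _] := arrA; rewrite mxrank_ker.
have -> : \rank (a i) = 1%N.
  apply/eqP; rewrite eqn_leq rank_leq_col lt0n mxrank_eq0; exact: a0.
rewrite subn1 prednK //; case: (d) (a i) (a0 i) => // u /eqP[]; exact: flatmx0.
Qed.

Lemma hyp_inj i j : (hyp a i <= hyp a j)%MS -> i = j.
Proof.
have [_ [hinj _]] := arrA; move=> ij; apply: hinj; rewrite ij /=.
by rewrite -(mxrank_leqif_sup ij) -eqSS !rank_hyp.
Qed.

Lemma rank_hyp_cap i j : i != j -> (\rank (hyp a i :&: hyp a j)%MS + 2)%N = d.
Proof.
move=> ij; have := mxrank_sum_cap (hyp a i) (hyp a j).
have : (hyp a i < hyp a i + hyp a j)%MS.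
  rewrite ltmxE addsmxSl /=; apply: contra ij => sub; apply/eqP/esym/hyp_inj.
  exact: submx_trans (addsmxSr _ _) sub.
move/rank_ltmx; have := rank_leq_col (hyp a i + hyp a j)%MS.
have := rank_hyp i; have := rank_hyp j; lia.
Qed.

Lemma flag_mono i j : (i <= j <= d)%N -> (F i <= F j)%MS.
Proof.
case/andP; elim: j => [|j IHj]; first by rewrite leqn0 => /eqP->.
rewrite leq_eqVlt => /predU1P[->//|ij] jd.
apply: submx_trans (IHj ij (ltnW jd)) _.
by have [_ _ _ /(_ j.+1)] := flagF; case.
Qed.

Definition level i : nat := \max_(j < d.+1 | (F j <= hyp a i)%MS) j.

(** The flag increases, so the indices [j] with [F j] inside a hyperplane form an initial
    segment. *)
Lemma levelP i j : (j <= d)%N -> (F j <= hyp a i)%MS = (j <= level i)%N.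
Proof.
move=> jd; apply/idP/idP => [Fj|jl].
  exact: (leq_bigmax_cond (Ordinal (jd : (j < d.+1)%N))).
have [/eqmxP F0 _ _ _] := flagF.
have [|k Fk lk] := @eq_bigmax_cond _ [pred k : 'I_d.+1 | (F k <= hyp a i)%MS] val.
  by apply/card_gt0P; exists ord0; rewrite inE F0 sub0mx.
apply: submx_trans Fk; apply: flag_mono; apply/andP; split; last by rewrite -ltnS ltn_ord.
by have <- : level i = k := lk.
Qed.

Lemma level_lt i : (level i < d)%N.
Proof.
have [_ /eqmxP Fd _ _] := flagF.
rewrite ltnNge -levelP // Fd sub1mx /row_full.
by have := rank_hyp i; case: eqP => // -> /eqP; rewrite gtn_eqF.
Qed.

(** Add up vectors of the closure of [c0] that span [F q]. All forms are nonnegative on them, so a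
    form vanishing on the sum vanishes on [F q]. *)
Lemma ex_flag_points : exists v : nat -> 'rV[R]_d, forall q, (q <= d)%N ->
  (v q <= F q)%MS /\ forall i, ~~ (F q <= hyp a i)%MS -> 0 < f i (v q).
Proof.
have : forall q : 'I_d.+1, exists u : 'rV[R]_d,
    (u <= F q)%MS /\ forall i, ~~ (F q <= hyp a i)%MS -> 0 < f i u.
  move=> q; have [|P [Pk FP]] := @incF q; first by rewrite -ltnS ltn_ord.
  have fP i k : 0 <= f i (row k P).
    have [/(_ i) + _] := Pk k; rewrite signed_linE.
    by case: (c0 i); rewrite ?expr0 ?expr1 ?mul1r // mulN1r oppr_ge0.
  exists (\sum_k row k P); split; first by apply: summx_sub => k _; case: (Pk k).
  move=> i nF; have -> : f i (\sum_k row k P) = \sum_k f i (row k P).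
    by rewrite /signed_lin mulmx_suml summxE.
  rewrite lt_neqAle sumr_ge0 // andbT eq_sym; apply: contra nF.
  rewrite psumr_eq0 // => /allP f0; apply: submx_trans FP _; apply/row_subP => k.
  by rewrite sub_hypP; apply: (implyP (f0 k _)); rewrite ?mem_index_enum.
(* Beyond [d], [inord] returns a default index; only [q <= d] matters. *)
case/fin_all_exists => u uP; exists (fun q => u (inord q)) => q qd.
by have := uP (inord q); rewrite inordK.
Qed.

Section Levels.
Variable v : nat -> 'rV[R]_d.
Hypothesis vP : forall q, (q <= d)%N ->
  (v q <= F q)%MS /\ forall i, ~~ (F q <= hyp a i)%MS -> 0 < f i (v q).

Lemma signed_lin_flag0 i q : (q <= level i)%N -> f i (v q) = 0.
Proof.
move=> qi; have qd : (q <= d)%N by rewrite (leq_trans qi) // ltnW // level_lt.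
apply/eqP; rewrite -sub_hypP; have [vF _] := vP qd; apply: submx_trans vF _.
by rewrite levelP.
Qed.

Lemma signed_lin_flag_gt0 i j q : (level i < q <= (level j).+1)%N -> 0 < f i (v q).
Proof.
case/andP=> iq qj; have qd : (q <= d)%N by rewrite (leq_trans qj) // level_lt.
by have [_] := vP qd; apply; rewrite levelP // -ltnNge.
Qed.

Local Notation h := (ht f level v).

Lemma ht_lin i x : h i x = (x *m ((f i (v (level i).+1))^-1 *: b i)) 0 0.
Proof. by rewrite -scalemxAr mxE mulrC. Qed.

Lemma signed_lin_top_gt0 i : 0 < f i (v (level i).+1).
Proof. by rewrite (@signed_lin_flag_gt0 _ i) // ltnS leqnn. Qed.

(** [v (level i).+1] is off the hyperplane [i], hence outside [F (level i)]; by dimension the two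
    together span the next flag member. *)
Lemma flagS_sub m (X : 'M[R]_(d, m)) i : (F (level i) <= kermx X)%MS ->
  v (level i).+1 *m X = 0 -> (F (level i).+1 <= kermx X)%MS.
Proof.
move=> FX /sub_kermxP vX; have ld := level_lt i; have [vF _] := vP ld.
have [_ _ rF _] := flagF.
have sub : (F (level i) + v (level i).+1 <= F (level i).+1)%MS.
  by rewrite addsmx_sub vF flag_mono // leqnSn.
have lt : (F (level i) < F (level i) + v (level i).+1)%MS.
  rewrite ltmxE addsmxSl addsmx_sub submx_refl /=; apply/negP => vi.
  have : (v (level i).+1 <= hyp a i)%MS by rewrite (submx_trans vi) // levelP // ltnW.
  by rewrite sub_hypP gt_eqF // signed_lin_top_gt0.
have : (F (level i).+1 <= F (level i) + v (level i).+1)%MS.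
  rewrite -(mxrank_leqif_sup sub) eqn_leq mxrankS //=.
  have [_ ->] := rF _ ld; have := rank_ltmx lt; by have [_ ->] := rF _ (ltnW ld).
by move/submx_trans; apply; rewrite addsmx_sub FX.
Qed.

Lemma signed_normal_inj i j l : b i = l *: b j -> i = j.
Proof.
move=> e; apply/esym/hyp_inj/rV_subP => x; rewrite !sub_hypP => /eqP fj.
have -> : f i x = l * f j x by rewrite /signed_lin e -scalemxAr mxE.
by rewrite fj mulr0.
Qed.

(** Both heights vanish on [F (level i)] and equal 1 at [v (level i).+1], so the difference vanishes
    on the next flag member as well as on the intersection of the two hyperplanes. By modularity
    these span some hyperplane [k], and the difference is a multiple of [f k]. *)
Lemma ht_sub_level i j : i != j -> level i = level j -> exists k (l : R),
  [/\ (level i < level k)%N, l != 0 & forall x, h i x - h j x = l * f k x].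
Proof.
move=> ij lij; have ld := level_lt i; have [_ _ _ /(_ (level i).+1)] := flagF.
case=> // _ _ _ /(_ i j ij); rewrite !levelP ?(ltnW ld) // -lij ltnn leqnn.
case=> // k [Fk /eqmxP hk].
pose g := (f i (v (level i).+1))^-1 *: b i + - (f j (v (level j).+1))^-1 *: b j.
have gP x : h i x - h j x = (x *m g) 0 0.
  by rewrite !ht_lin /g scaleNr mulmxBr !mxE.
have Fg : (F (level i).+1 <= kermx g)%MS.
  apply: flagS_sub.
    by apply: sub_kermx_lin; rewrite -sub_hyp_signed levelP -?lij // ltnW.
  rewrite [LHS]mx11_scalar -gP /ht -lij.
  by rewrite !divff ?subrr ?raddf0 // gt_eqF // ?signed_lin_top_gt0 // lij signed_lin_top_gt0.
have [l gE] : exists l : R, g = l *: b k.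
  have kk : (kermx (b k) <= hyp a k)%MS by rewrite sub_hyp_signed.
  apply: sub_kermx_col; apply: submx_trans kk _.
  rewrite -hk addsmx_sub Fg.
  by apply: sub_kermx_lin; rewrite -sub_hyp_signed ?capmxSl ?capmxSr.
exists k, l; split.
- by rewrite -levelP // -hk addsmxSl.
- apply: contra ij => /eqP l0; apply/eqP; move/eqP: gE; rewrite l0 scale0r /g scaleNr subr_eq0.
  move/eqP/(congr1 (fun u => f i (v (level i).+1) *: u)).
  rewrite (scalerA _ _ (b i)) (scalerA _ _ (b j)) mulfV ?scale1r; last by rewrite gt_eqF // signed_lin_top_gt0.
  exact: signed_normal_inj.
- by move=> x; rewrite gP gE -scalemxAr mxE.
Qed.

(** The normal of [m] is a combination of those of [j] and [k]. If the coefficient of [j] is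
    nonzero, evaluation at [v (level j).+1], where [f k] vanishes, bounds the level of [m] by that
    of [j], and the inclusion of [F (level j)] gives the converse. *)
Lemma sub_cap_hypP j k m : (level j < level k)%N ->
  (hyp a j :&: hyp a k <= hyp a m)%MS <->
  m = k \/ (level m = level j /\ exists l, forall x, h m x - h j x = l * f k x).
Proof.
move=> jk; have ld := level_lt; split=> [sub|].
  have [l [l' mE]] : exists l l' : R, b m = l *: b j + l' *: b k.
    apply: sub_cap_kermx_col; rewrite -sub_hyp_signed; apply: submx_trans sub.
    by rewrite sub_capmx (sub_hyp_signed _ j) (sub_hyp_signed _ k) capmxSl capmxSr.
  have fmE x : f m x = l * f j x + l' * f k x.
    by rewrite /signed_lin mE mulmxDr -!scalemxAr !mxE.
  have [l0|l_neq0] := eqVneq l 0.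
    by left; apply: (@signed_normal_inj m k l'); rewrite mE l0 scale0r add0r.
  have fj0 : f j (v (level j).+1) != 0 by rewrite gt_eqF // signed_lin_top_gt0.
  have fm : f m (v (level j).+1) = l * f j (v (level j).+1).
    by rewrite fmE (signed_lin_flag0 (i := k)) // mulr0 addr0.
  have lmj : level m = level j.
    apply/eqP; rewrite eqn_leq; apply/andP; split.
      rewrite leqNgt; apply/negP => /signed_lin_flag0/eqP.
      by rewrite fm mulf_eq0 (negPf l_neq0) (negPf fj0).
    rewrite -levelP; last exact: ltnW.
    by apply: submx_trans sub; rewrite sub_capmx !levelP ?(ltnW (ld _)) // leqnn ltnW.
  right; split=> //; exists (l' / (l * f j (v (level j).+1))) => x.
  rewrite /ht lmj fm fmE; move: (f j _) fj0 (f j x) (f k x) => p p0 q r.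
  by field; rewrite l_neq0 p0.
case=> [->|[lmj [l lP]]]; first exact: capmxSr.
apply/rV_subP => x; rewrite sub_capmx !sub_hypP => /andP[/eqP fj /eqP fk].
have := lP x; rewrite fk mulr0 /ht fj mul0r subr0 => /eqP.
by rewrite mulf_eq0 invr_eq0 [_ (v _) == 0]gt_eqF ?orbF // signed_lin_top_gt0.
Qed.

End Levels.
End Flag.

(** * Flats of codimension 2 *)

Section Codim2.
Variables (R : realType) (d n : nat) (a : 'I_n -> 'cV[R]_d).
Hypothesis arrA : arrangement a.

(** The canonical generator makes equal subspaces equal matrices, as in [Lk]. *)
Definition pair_flat j k : 'M[R]_d := <<flat_of a [set j; k]>>%MS.

Lemma pair_flatE j k : (pair_flat j k :=: hyp a j :&: hyp a k)%MS.
Proof.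
apply: eqmx_trans (genmxE _) _; apply/eqmxP/andP; split.
  by rewrite sub_capmx /flat_of; apply/andP; split; apply: bigcapmx_inf (submx_refl _);
    rewrite !inE eqxx ?orbT.
by apply/sub_bigcapmxP => i; rewrite !inE => /orP[]/eqP->; rewrite (capmxSl, capmxSr).
Qed.

Lemma mem_Lk2 X : X \in Lk a 2 -> <<X>>%MS = X /\ (\rank X + 2)%N = d.
Proof.
rewrite mem_undup => /mapP[T]; rewrite mem_filter => /andP[/eqP rT _] ->.
by rewrite genmx_id genmxE.
Qed.

Lemma pair_flat_Lk2 j k : j != k -> pair_flat j k \in Lk a 2.
Proof.
move=> jk; rewrite mem_undup; apply/map_f; rewrite mem_filter mem_enum inE andbT.
by rewrite -[flat_of _ _]/(id _) -(genmxE (flat_of _ _)) pair_flatE; apply/eqP/rank_hyp_cap.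
Qed.

Lemma Lk2_pair_flat X i m : i != m -> X \in Lk a 2 ->
  (X <= hyp a i)%MS -> (X <= hyp a m)%MS -> X = pair_flat i m.
Proof.
move=> im /mem_Lk2[gX rX] Xi Xm; rewrite -gX -[RHS]genmx_id; apply/genmxP.
have sub : (X <= pair_flat i m)%MS by rewrite pair_flatE sub_capmx Xi.
apply/andP; split=> //; rewrite -(mxrank_leqif_sup sub) pair_flatE.
by rewrite -(eqn_add2r 2) rX rank_hyp_cap.
Qed.

End Codim2.

(** * Incidence and distance in the graph of minimal galleries *)

Section Main.
Variables (R : realType) (d n : nat) (a : 'I_n -> 'cV[R]_d) (F : nat -> 'M[R]_d).
Variables (c0 c : sv n) (y : 'rV[R]_d) (v : nat -> 'rV[R]_d).
Hypothesis arrA : arrangement a.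
Hypothesis flagF : modular_flag a F.
Hypothesis c0_chamber : is_chamber a c0.
Hypothesis yP : forall i, if c i then 0 < lin a y i else lin a y i < 0.
Hypothesis vP : forall q, (q <= d)%N ->
  (v q <= F q)%MS /\ forall i, ~~ (F q <= hyp a i)%MS -> 0 < signed_lin a c0 i (v q).

Local Notation f := (signed_lin a c0).
Local Notation level := (level a F).
Local Notation gal := (gallery_of c0).

Lemma order_on_gallery_of X w : order_on a c0 X (gal w) = [seq i <- w | (X <= hyp a i)%MS].
Proof. by rewrite /order_on crossings_gallery_of. Qed.

(** A consecutive pair [i], [j] of increasing level violates incidence at the flag indices [level i]
    and [level j]; conversely, incidence only compares hyperplanes of different levels. *)
Lemma gallery_incidentP w : good f y w ->
  gallery_incident a c0 c F (gal w) <-> pairwise (levge level) w.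
Proof.
move=> gw; have [uw _ _] := gw; rewrite /gallery_incident crossings_gallery_of; split.
  move=> inc; rewrite -levge_sorted; apply: contraT.
  case/not_sorted_split => s1 [i [j [s2 [wE _]]]]; rewrite /levge -ltnNge => ij.
  have [iw jw] : i \in w /\ j \in w by rewrite wE !mem_cat !inE !eqxx !orbT.
  have ld := level_lt arrA flagF.
  have := inc (level i) (level j); rewrite ij ltnW ?ld // => /(_ isT j i).
  rewrite -!(good_mem yP _ gw) !levelP ?(ltnW (ld _)) // !leqnn -ltnNge.
  move=> /(_ jw iw isT isT ij); move: uw; rewrite wE cat_uniq !index_cat.
  case/and3P => _ /hasPn ns1 /= /andP[]; rewrite inE => /norP[nij _] _.
  have /negPf-> : i \notin s1 by apply: ns1; rewrite mem_head.
  have /negPf-> : j \notin s1 by apply: ns1; rewrite !inE eqxx orbT.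
  by rewrite eqxx (negPf nij) eqxx addn0 ltnNge leq_addr.
move=> lw i j /andP[ij jd] h h'; rewrite -!(good_mem yP _ gw) => hw hw'.
have id := leq_trans (ltnW ij) jd.
rewrite !(levelP flagF) // -ltnNge => jh _ h'j.
rewrite ltnNge leq_eqVlt; apply/negP => /predU1P[/(congr1 (nth h w))|lt].
  by rewrite !nth_index // => e; move: h'j; rewrite e ltnNge jh.
have /(pairwiseP h)/(_ _ _ _ _ lt) := lw; rewrite !inE !index_mem => /(_ hw' hw).
by rewrite !nth_index // /levge leqNgt (leq_trans h'j).
Qed.

(** The lower bound on distances: by the triangle inequality, each edge adds at most one flat. *)
Lemma leq_L2rr_size r0 p : path (G2adj a c0 c) r0 p ->
  (size (L2rr a c0 c r0 (last r0 p)) <= size p)%N.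
Proof.
elim/last_ind: p => [|p r IHp] /=.
  by rewrite /L2rr size_filter leqNgt -has_count => _; apply/hasPn => X _; rewrite eqxx.
rewrite rcons_path last_rcons size_rcons => /andP[/IHp IH /eqP adj].
rewrite -addn1 -adj; apply: leq_trans (leq_add IH (leqnn _)).
exact: leq_size_filter_neq.
Qed.

(** The reversal of [flip] shows only at [X0]: any other flat of codimension 2 lies in at most one
    hyperplane through [X0]. *)
Lemma G2_flip w0 w : good f y w0 -> pairwise (levge level) w0 ->
  good f y w -> w != w0 ->
  exists w', [/\ good f y w', G2adj a c0 c (gal w') (gal w) &
    size (L2rr a c0 c (gal w0) (gal w)) = (size (L2rr a c0 c (gal w0) (gal w'))).+1].
Proof.
move=> gw0 lw0 gw ww0.
have [j [k [w' [gw' jk flw [neq eq0] same]]]] :=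
  flip (@signed_linD _ _ _ a c0) (signed_lin_flag0 arrA flagF vP)
    (signed_lin_flag_gt0 arrA flagF vP) (ht_sub_level arrA flagF vP)
    (sub_cap_hypP arrA flagF vP) gw gw0 lw0 ww0.
have jk_neq : j != k by apply: contraTneq jk => ->; rewrite ltnn.
pose X0 := pair_flat a j k.
have X0P m : (X0 <= hyp a m)%MS = (hyp a j :&: hyp a k <= hyp a m)%MS.
  by rewrite /X0 pair_flatE.
have X0L : X0 \in L2cc a c0 c.
  rewrite mem_filter pair_flat_Lk2 // andbT; apply/forallP => m; apply/implyP.
  by rewrite X0P => /flw; rewrite (good_mem yP m gw).
have uL : uniq (L2cc a c0 c) by rewrite filter_uniq // undup_uniq.
have other X : X \in L2cc a c0 c -> X != X0 ->
    order_on a c0 X (gal w) = order_on a c0 X (gal w').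
  rewrite mem_filter => /andP[_ XL] XX0; rewrite !order_on_gallery_of; apply: same.
  move=> i m; rewrite -!X0P => X0i X0m Xi Xm; apply: contraNeq XX0 => im.
  rewrite (Lk2_pair_flat arrA im XL Xi Xm); apply/eqP/esym.
  by apply: Lk2_pair_flat; rewrite // pair_flat_Lk2.
have oX0 u : order_on a c0 X0 (gal u) = [seq i <- u | (hyp a j :&: hyp a k <= hyp a i)%MS].
  by rewrite order_on_gallery_of; apply: eq_filter => i; rewrite X0P.
exists w'; split=> //.
  apply/eqP; apply: (size_filter_pred1 uL X0L); first by rewrite !oX0 eq_sym.
  by move=> X XL XX0; rewrite (other X XL XX0) eqxx.
apply: (size_filter_flip uL X0L); first by rewrite !oX0 -eq0 eq_sym.
  by rewrite !oX0 eq0 eqxx.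
by move=> X XL XX0; rewrite (other X XL XX0).
Qed.

(** Induction on the number of flats: [G2_flip] yields a neighbour of [w] closer to [w0], and its
    walk is extended by [w]. With no flat left, a flip is impossible and [w] is [w0]. *)
Lemma G2_walk w0 w m : good f y w0 -> pairwise (levge level) w0 -> good f y w ->
  size (L2rr a c0 c (gal w0) (gal w)) = m ->
  exists p, G2walk a c0 c (gal w0) p /\ last (gal w0) p = gal w /\ size p = m.
Proof.
move=> gw0 lw0; elim: m w => [|m IHm] w gw.
  move=> sz; exists [::]; split=> //; split=> //; congr gal; apply/esym/eqP.
  by apply: contraT => /(G2_flip gw0 lw0 gw)[w' [_ _]]; rewrite sz.
have [->|/(G2_flip gw0 lw0 gw)[w' [gw' adj ->]]] := eqVneq w w0.
  by move=> sz; have := @leq_L2rr_size (gal w0) [::] isT; rewrite /= sz.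
case=> /(IHm _ gw')[p [[pm pp] [pl ps]]]; exists (rcons p (gal w)).
rewrite last_rcons size_rcons ps; split=> //; split; last by rewrite rcons_path pp pl.
move=> s; rewrite mem_rcons inE => /predU1P[->|]; last exact: pm.
by apply/(min_galleryP c0_chamber yP _ gw0); exists w.
Qed.

End Main.

Theorem theorem5p5 (R : realType) (d n : nat) (a : 'I_n -> 'cV[R]_d)
    (F : nat -> 'M[R]_d) (c0 c : {ffun 'I_n -> bool}) :
  arrangement a -> supersolvable a -> modular_flag a F ->
  is_chamber a c0 -> chamber_incident_flag a F c0 ->
  is_chamber a c -> c != c0 ->
  exists r0 : seq {ffun 'I_n -> bool},
    (min_gallery a c0 c r0 /\ gallery_incident a c0 c F r0 /\
     forall r, min_gallery a c0 c r -> gallery_incident a c0 c F r -> r = r0) /\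
    forall r, min_gallery a c0 c r ->
      G2dist_eq a c0 c r0 r (size (L2rr a c0 c r0 r)).
Proof.
move=> arrA _ flagF c0_chamber incF [y yP] _.
have [v vP] := ex_flag_points incF.
have [w0 gw0 lw0] := ex_levge_good (@signed_linD _ _ _ a c0)
  (signed_lin_flag0 arrA flagF vP) (signed_lin_flag_gt0 arrA flagF vP)
  (ht_sub_level arrA flagF vP) (target_neq0 c0 yP).
have mingP := fun g => min_galleryP c0_chamber yP g gw0.
exists (gallery_of c0 w0); split; [split; last split|].
- by apply/mingP; exists w0.
- exact: (proj2 (gallery_incidentP arrA flagF yP gw0)).
- move=> _ /mingP[w gw ->] /(proj1 (gallery_incidentP arrA flagF yP gw)) lw.
  congr gallery_of.
  exact: (levge_good_uniq (signed_lin_flag_gt0 arrA flagF vP)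
    (ht_sub_level arrA flagF vP) gw gw0 lw lw0).
- move=> _ /mingP[w gw ->]; split; first exact: (G2_walk arrA flagF c0_chamber yP vP gw0 lw0 gw erefl).
  by move=> p [_ pp] <-; apply: leq_L2rr_size.
Qed.
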